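(* Let $\mathcal{O}$ be an order in an imaginary quadratic field, let $F\subset\mathbb{C}$ be a fundamental polygon for $\mathcal{O}$, and let $\mathcal{F}$ be the corresponding Ford domain of the projective elementary group $\mathrm{PE}_2(\mathcal{O})$. Then the only Euclidean hemispheres that contribute a face to $\mathcal{F}$ are those of radius $1$ centered on elements of $\mathcal{O}$. That is, if $g\in\mathrm{PE}_2(\mathcal{O})$ has nonzero bottom-left entry and its isometric hemisphere $S_g$ contributes a face to $\mathcal{F}$, then $S_g$ has radius $1$ and its center is an element of $\mathcal{O}$.
   Context: $\mathrm{PE}_2(\mathcal{O})$ is the subgroup of $\mathrm{PSL}_2(\mathcal{O})$ generated by the (classes of) elementary matrices, i.e. the diagonal, (upper or lower) triangular, or permutation matrices in $\mathrm{PSL}_2(\mathcal{O})$; the permutation-type matrix is $\begin{bmatrix}0&-1\\1&0\end{bmatrix}$. $\mathbb{H}=\{(\zeta,t)\mid \zeta\in\mathbb{C},\ t\in(0,\infty)\}$ is the upper half-space model of hyperbolic 3-space with the usual action of $\mathrm{PSL}_2(\mathbb{C})$ by isometries extending Möbius transformations of $\mathbb{C}\cup\{\infty\}$. For $P\in\mathbb{H}$, $\zeta(P)$ and $t(P)$ denote its first and second coordinates. For $g=\begin{bmatrix}\delta&-\gamma\\-\beta&\alpha\end{bmatrix}\in\mathrm{PSL}_2(\mathcal{O})$ one has $t(gP)=\dfrac{t(P)}{|\alpha-\beta\zeta(P)|^2+|\beta|^2t(P)^2}$. A fundamental polygon $F\subset\mathbb{C}$ for $\mathcal{O}$ is a polygon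 whose translates by elements of the lattice $\mathcal{O}$ tessellate $\mathbb{C}$; $\overline F$ is its closure. Given $F$, the Ford domain of a subgroup $\Gamma\le\mathrm{PSL}_2(\mathcal{O})$ is $$\mathcal{F}=\{P\in\mathbb{H}\mid \zeta(P)\in\overline F,\ t(P)\ge t(gP)\text{ for all }g\in\Gamma\}.$$ For $g=\begin{bmatrix}\delta&-\gamma\\-\beta&\alpha\end{bmatrix}$ with $\beta\ne0$, the isometric hemisphere of $g$ is $S_g=\{P\in\mathbb{H}\mid t(P)=t(gP)\}$, which is the open Euclidean hemisphere centered at $\alpha/\beta\in\mathbb{C}\subset\partial\mathbb{H}$ with radius $1/|\beta|$. So $\mathcal{F}$ consists of the points above $\overline F$ lying on or outside $S_g$ for every such $g\in\Gamma$. The hemisphere $S_g$ contributes a face to $\mathcal{F}$ if $S_g\cap\mathcal{F}$ is two-dimensional, i.e. has nonempty interior as a subset of $S_g$. *)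

(* Defs.v *)
From HB Require Import structures.
From mathcomp Require Import all_boot all_order all_algebra all_field.
From mathcomp Require Import all_classical all_reals all_analysis.
From mathcomp Require Import complex ring.
Import Order.TTheory GRing.Theory Num.Theory.
Import numFieldNormedType.Exports.

Set Implicit Arguments.
Unset Strict Implicit.
Unset Printing Implicit Defensive.

Local Open Scope classical_set_scope.
Local Open Scope ring_scope.
Local Open Scope complex_scope.

(* The topology of [R[i]] given by its modulus. *)
HB.instance Definition _ (R : realType) := NormedModule.copy R[i] R[i]^o.

Notation normc := ComplexField.Normc.normc.

Section ProjectiveSpecialLinear.
Variable F : fieldType.

Record SL2 := MkSL2 { SL2_mx :> 'M[F]_2; SL2_mxP : \det SL2_mx == 1 }.

HB.instance Definition _ := [isSub for SL2_mx].
HB.instance Definition _ := [Choice of SL2 by <:].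

Lemma det_SL2 (M : SL2) : \det (M : 'M[F]_2) = 1.
Proof. exact/eqP/SL2_mxP. Qed.

Lemma SL2_unitmx (M : SL2) : (M : 'M[F]_2) \in unitmx.
Proof. by rewrite unitmxE det_SL2 unitr1. Qed.

Lemma SL2_one_subproof : \det (1%:M : 'M[F]_2) == 1.
Proof. by rewrite det1. Qed.

Lemma SL2_mul_subproof (M N : SL2) : \det (M *m N : 'M[F]_2) == 1.
Proof. by rewrite det_mulmx !det_SL2 mulr1. Qed.

Lemma SL2_inv_subproof (M : SL2) : \det (invmx M : 'M[F]_2) == 1.
Proof. by rewrite det_inv det_SL2 invr1. Qed.

Lemma SL2_opp_subproof (M : SL2) : \det (- (M : 'M[F]_2)) == 1.
Proof. by rewrite -scaleN1r detZ det_SL2 sqrrN expr1n mulr1. Qed.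

Definition SL2_one : SL2 := MkSL2 SL2_one_subproof.
Definition SL2_mul (M N : SL2) : SL2 := MkSL2 (SL2_mul_subproof M N).
Definition SL2_inv (M : SL2) : SL2 := MkSL2 (SL2_inv_subproof M).
Definition SL2_opp (M : SL2) : SL2 := MkSL2 (SL2_opp_subproof M).

Lemma SL2_mulA : associative SL2_mul.
Proof. by move=> M N P; apply/val_inj; rewrite /= mulmxA. Qed.
Lemma SL2_mul1 : left_id SL2_one SL2_mul.
Proof. by move=> M; apply/val_inj; rewrite /= mul1mx. Qed.
Lemma SL2_mulr1 : right_id SL2_one SL2_mul.
Proof. by move=> M; apply/val_inj; rewrite /= mulmx1. Qed.
Lemma SL2_mulV : left_inverse SL2_one SL2_inv SL2_mul.
Proof. by move=> M; apply/val_inj; rewrite /= mulVmx ?SL2_unitmx. Qed.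
Lemma SL2_mulrV : right_inverse SL2_one SL2_inv SL2_mul.
Proof. by move=> M; apply/val_inj; rewrite /= mulmxV ?SL2_unitmx. Qed.

HB.instance Definition _ :=
  isGroup.Build SL2 SL2_mulA SL2_mul1 SL2_mulr1 SL2_mulV SL2_mulrV.

Definition eq_up_to_sign (M N : SL2) := (M == N) || (M == SL2_opp N).

Lemma SL2_oppK : involutive SL2_opp.
Proof. by move=> M; apply/val_inj; rewrite /= opprK. Qed.

Lemma eq_up_to_sign_refl : reflexive eq_up_to_sign.
Proof. by move=> M; rewrite /eq_up_to_sign eqxx. Qed.

Lemma eq_up_to_sign_sym : symmetric eq_up_to_sign.
Proof.
move=> M N; rewrite /eq_up_to_sign eq_sym; congr orb.
by rewrite eq_sym (can2_eq SL2_oppK SL2_oppK).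
Qed.

Lemma eq_up_to_sign_trans : transitive eq_up_to_sign.
Proof.
move=> N M P /orP[]/eqP-> /orP[]/eqP->;
  by rewrite /eq_up_to_sign ?SL2_oppK eqxx ?orbT.
Qed.

Canonical eq_up_to_sign_equiv :=
  EquivRel eq_up_to_sign eq_up_to_sign_refl eq_up_to_sign_sym
           eq_up_to_sign_trans.

Definition PSL2 := {eq_quot eq_up_to_sign}%qT.

HB.instance Definition _ := Choice.on PSL2.
HB.instance Definition _ := EqQuotient.on PSL2.

Local Open Scope quotient_scope.

Definition PSL2_class (M : SL2) : PSL2 := \pi M.

Lemma PSL2_classP (M N : SL2) :
  PSL2_class M = PSL2_class N <->
  (M : 'M[F]_2) = N \/ (M : 'M[F]_2) = - (N : 'M[F]_2).
Proof.
split=> [/eqmodP/orP[]/eqP->|[] MN]; [by left|by right| |];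
  apply/eqmodP; apply/orP; [left|right]; exact/eqP/val_inj.
Qed.

Definition PSL2_one : PSL2 := PSL2_class 1%g.
Definition PSL2_mul (g h : PSL2) : PSL2 := PSL2_class (repr g * repr h)%g.
Definition PSL2_inv (g : PSL2) : PSL2 := PSL2_class (repr g)^-1%g.

Lemma PSL2_class_repr (g : PSL2) : PSL2_class (repr g) = g.
Proof. exact: reprK. Qed.

Lemma repr_PSL2_class (M : SL2) :
  (repr (PSL2_class M) : 'M[F]_2) = M \/
  (repr (PSL2_class M) : 'M[F]_2) = - (M : 'M[F]_2).
Proof. exact/PSL2_classP/PSL2_class_repr. Qed.

Lemma PSL2_classM (M N : SL2) :
  PSL2_class (M * N)%g = PSL2_mul (PSL2_class M) (PSL2_class N).
Proof.
apply/PSL2_classP => /=.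
by have [->|->] := repr_PSL2_class M; have [->|->] := repr_PSL2_class N;
  rewrite ?(mulmxN, mulNmx) ?opprK; [left|right|right|left].
Qed.

Lemma PSL2_classV (M : SL2) :
  PSL2_class (M^-1)%g = PSL2_inv (PSL2_class M).
Proof.
apply/PSL2_classP => /=.
have [->|->] := repr_PSL2_class M; [by left|right].
apply: (can_inj (mulKmx (SL2_unitmx M))).
rewrite mulmxN mulmxV ?SL2_unitmx// -mulNmx mulmxV//.
by rewrite -[- _]/(val (SL2_opp M)) SL2_unitmx.
Qed.

Lemma PSL2_mulA : associative PSL2_mul.
Proof.
move=> g h k.
rewrite -[g]PSL2_class_repr -[h]PSL2_class_repr -[k]PSL2_class_repr.
by rewrite -!PSL2_classM mulgA.
Qed.
Lemma PSL2_mul1 : left_id PSL2_one PSL2_mul.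
Proof.
by move=> g; rewrite -[g]PSL2_class_repr -PSL2_classM mul1g.
Qed.
Lemma PSL2_mulr1 : right_id PSL2_one PSL2_mul.
Proof.
by move=> g; rewrite -[g]PSL2_class_repr -PSL2_classM mulg1.
Qed.
Lemma PSL2_mulV : left_inverse PSL2_one PSL2_inv PSL2_mul.
Proof.
by move=> g; rewrite -[g]PSL2_class_repr -PSL2_classV -PSL2_classM mulVg.
Qed.
Lemma PSL2_mulrV : right_inverse PSL2_one PSL2_inv PSL2_mul.
Proof.
by move=> g; rewrite -[g]PSL2_class_repr -PSL2_classV -PSL2_classM mulgV.
Qed.

HB.instance Definition _ :=
  isGroup.Build PSL2 PSL2_mulA PSL2_mul1 PSL2_mulr1 PSL2_mulV PSL2_mulrV.

(* One of the two matrices representing [g]; everything defined through it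
   below is insensitive to a change of sign. *)
Definition PSL2_mx (g : PSL2) : 'M[F]_2 := repr g.

End ProjectiveSpecialLinear.

Definition is_subgroup (G : groupType) (H : set G) :=
  [/\ H 1%g, forall x y, H x -> H y -> H (x * y)%g
    & forall x, H x -> H x^-1%g].

Section ElementaryGroup.
Variable F : fieldType.

Definition permutation_mx2 : 'M[F]_2 :=
  \matrix_(i, j) (if i == j then 0 else if i == 0 then -1 else 1).

Definition elementary_mx (M : 'M[F]_2) :=
  [|| is_diag_mx M, is_trig_mx M, is_trig_mx M^T | M == permutation_mx2].

Definition SL2_over (A : set F) : set (SL2 F) :=
  [set M | forall i j, A ((M : 'M[F]_2) i j)].

(* The generators have entries in [A], so for a subring [A] this is a subgroup
   of the image of SL_2(A) in PSL_2(F). *)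
Definition PE2 (A : set F) : set (PSL2 F) :=
  smallest (@is_subgroup (PSL2 F))
    [set PSL2_class M | M in SL2_over A `&` [set M | elementary_mx M]].

End ElementaryGroup.

(* [iota] is the embedding through which the abstract quadratic field [K] is
   viewed inside the complex numbers. *)
Definition imaginary_quadratic (R : realType) (K : fieldExtType rat)
    (iota : {rmorphism K -> R[i]}) :=
  \dim {:K} = 2%N /\ exists x : K, Im (iota x) != 0.

Definition is_order (K : fieldExtType rat) (O : {pred K}) :=
  GRing.subring_closed O /\
  exists2 X : (\dim {:K}).-tuple K,
    basis_of {:K} X & forall x, x \in O <-> inIntSpan X x.

Section Polygon.
Variable R : realType.
Local Notation C := R[i].

Definition segment (z w : C) : set C :=
  [set (1 - s)%:C * z + s%:C * w | s in `[0, 1]%classic].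

Definition edge n (v : 'I_n -> C) (i : 'I_n) : set C :=
  segment (v i) (v (ordS i)).

Definition simple_closed_chain n (v : 'I_n -> C) :=
  [/\ (2 < n)%N, injective v
    & forall i j : 'I_n, i != j -> forall z, edge v i z -> edge v j z ->
        (j = ordS i /\ z = v j) \/ (i = ordS j /\ z = v i)].

(* A polygonal region: its interior is a bounded domain whose boundary is a
   simple closed polygonal chain (by the Jordan curve theorem, the inside of
   that chain), and nothing is imposed on which boundary points belong to [F]. *)
Definition is_polygon (F : set C) :=
  exists n, exists2 v : 'I_n -> C, simple_closed_chain v &
    [/\ bounded_set F°, connected F°,
        closure F° `\` F° = \bigcup_i edge v i
      & F `<=` closure F°].

Definition translate (a : C) (X : set C) : set C := [set z + a | z in X].

Definition tessellates (A : set C) (F : set C) :=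
  \bigcup_(a in A) translate a (closure F) = setT /\
  trivIset A (fun a => translate a F°).

Definition fundamental_polygon (A : set C) (F : set C) :=
  is_polygon F /\ tessellates A F.

End Polygon.

Section HyperbolicSpace.
Variable R : realType.
Local Notation C := R[i].

Definition upper_half_space : set (C * R) := [set P | 0 < P.2].

(* The Poincare extension of the Moebius transformation of [M]; it is only
   meaningful for [\det M = 1] and on [upper_half_space]. *)
Definition poincare_mx (M : 'M[C]_2) (P : C * R) : C * R :=
  let a := M 0 0 in let b := M 0 1 in let c := M 1 0 in let d := M 1 1 in
  let z := P.1 in let t := P.2 in
  let D := normc (c * z + d) ^+ 2 + normc c ^+ 2 * t ^+ 2 in
  (((a * z + b) * conjc (c * z + d) + a * conjc c * (t ^+ 2)%:C) / D%:C, t / D).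

Lemma poincare_mxN (M : 'M[C]_2) P : poincare_mx (- M) P = poincare_mx M P.
Proof.
rewrite /poincare_mx !mxE !mulNr -!opprD !(@normcN R).
have cN (z : C) : conjc (- z) = - conjc z by rewrite rmorphN.
by rewrite !cN mulrNN mulrN mulNr opprK.
Qed.

Definition psl2_act (g : PSL2 C) (P : C * R) : C * R :=
  poincare_mx (PSL2_mx g) P.

(* [g] is written as the matrix with rows (delta, -gamma) and (-beta, alpha). *)
Definition alpha (g : PSL2 C) : C := PSL2_mx g 1 1.
Definition beta (g : PSL2 C) : C := - PSL2_mx g 1 0.

Definition isometric_hemisphere (g : PSL2 C) : set (C * R) :=
  [set P | upper_half_space P /\ P.2 = (psl2_act g P).2].

Definition hemisphere (c : C) (r : R) : set (C * R) :=
  [set P | upper_half_space P /\ normc (P.1 - c) ^+ 2 + P.2 ^+ 2 = r ^+ 2].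

Definition isometric_center (g : PSL2 C) : C := alpha g / beta g.
Definition isometric_radius (g : PSL2 C) : R := (normc (beta g))^-1.

Definition ford_domain (G : set (PSL2 C)) (F : set C) : set (C * R) :=
  [set P | [/\ upper_half_space P, closure F P.1
             & forall g, G g -> (psl2_act g P).2 <= P.2]].

(* The interior is taken in the subspace topology of [S]. *)
Definition contributes_face (S D : set (C * R)) :=
  @interior (subspace S) (S `&` D) !=set0.

Lemma psl2_act_height g P :
  (psl2_act g P).2 =
  P.2 / (normc (alpha g - beta g * P.1) ^+ 2 + normc (beta g) ^+ 2 * P.2 ^+ 2).
Proof.
by rewrite /alpha /beta (@normcN R) mulNr opprK [_ 1 1 + _]addrC.
Qed.

Lemma isometric_hemisphereE g : beta g != 0 ->
  isometric_hemisphere g = hemisphere (isometric_center g) (isometric_radius g).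
Proof.
move=> b0; have nb0 : normc (beta g) != 0.
  by apply: contra b0 => /eqP/ComplexField.Normc.eq0_normc ->.
have Db z t :
    normc (alpha g - beta g * z) ^+ 2 + normc (beta g) ^+ 2 * t ^+ 2 =
    normc (beta g) ^+ 2 * (normc (z - alpha g / beta g) ^+ 2 + t ^+ 2).
  have -> : alpha g - beta g * z = - (beta g * (z - alpha g / beta g)).
    by rewrite mulrBr mulrCA divff// mulr1 opprB.
  by rewrite (@normcN R) ComplexField.Normc.normcM exprMn -mulrDr.
rewrite /isometric_hemisphere /hemisphere /isometric_radius /isometric_center.
apply/seteqP; split=> P; rewrite /mkset psl2_act_height Db exprVn => -[t0].
- move=> PD; split=> //; move: PD.
  set D := normc _ ^+ 2 + _ => PD.
  apply: (mulfI (expf_neq0 2 nb0)); rewrite mulfV ?expf_neq0//.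
  apply: invr_inj; rewrite invr1; apply: (mulfI (lt0r_neq0 t0)).
  by rewrite mulr1 -PD.
- by move=> ->; split=> //; rewrite mulfV ?expf_neq0// divr1.
Qed.

End HyperbolicSpace.

(* Main.v *)
Require Import Defs.
From HB Require Import structures.
From mathcomp Require Import all_boot all_order all_algebra all_field.
From mathcomp Require Import all_classical all_reals all_analysis.
From mathcomp Require Import complex ring lra.
Import Order.TTheory GRing.Theory Num.Theory.
Import numFieldNormedType.Exports.

(* Let Q(c, d) = |c z + d|^2 + |c|^2 t^2, so that t(gP) = t(P) / Q(c, d) for
   P = (z, t) and (c, d) the bottom row of g.  Bottom rows are vertices of the
   graph on pairs of elements of the order in which u and v are adjacent when
   |det(u, v)| = 1, and the rows of PE_2 are connected to e = (0, 1).  The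
   neighbours of e give the unit hemispheres centred on the order, so being
   outside these says that e is a local minimum of Q on the graph.

   A local minimum is a global one on a connected component.  At a peak k of Q on
   a path, the two neighbours differ by x k up to a unit, with |x|^2 an integer
   less than 4, and in each case 0, 1, 2, 3 the path can be rerouted below k.
   Values of Q on the lattice being discrete, a path from e to a vertex of smaller
   value can be rerouted until it leaves e downwards, which is absurd.

   Hence P in the interior of a face of S_g lies on a unit hemisphere H centred on
   the order: otherwise a slightly lower point would still be outside all unit
   hemispheres but strictly inside S_g.  The difference of the defining equations
   of H and S_g is a real affine function of z, of constant sign near P and zero
   at P, so it vanishes and S_g = H. *)

Set Implicit Arguments.
Unset Strict Implicit.
Unset Printing Implicit Defensive.

Local Open Scope classical_set_scope.
Local Open Scope ring_scope.
Local Open Scope complex_scope.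

(** Makes the termination measure of [no_descending_path] drop strictly. *)
Lemma ltn_count (T : eqType) (p q : pred T) (s : seq T) x :
  subpred p q -> x \in s -> ~~ p x -> q x -> (count p s < count q s)%N.
Proof.
move=> pq + px qx; elim: s => //= y s IHs; rewrite in_cons => /orP[/eqP <-|xs].
  by rewrite (negPf px) qx add1n ltnS sub_count.
rewrite -addnS leq_add ?IHs//.
by case: (p y) (pq y) => // ->.
Qed.

(** * The Hermitian form of a point of hyperbolic space *)

Section HermitianForm.
Variable R : realType.
Local Notation C := R[i].
Implicit Types (x y : C) (u v w k a : C * C).

Definition sqnorm x : R := complex.Re x ^+ 2 + complex.Im x ^+ 2.

Lemma sqnorm_ge0 x : 0 <= sqnorm x.
Proof. by rewrite addr_ge0 ?sqr_ge0. Qed.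

Lemma sqnormE x : normc x ^+ 2 = sqnorm x.
Proof. by case: x => p q; rewrite /= sqr_sqrtr// addr_ge0 ?sqr_ge0. Qed.

Lemma sqnormM x y : sqnorm (x * y) = sqnorm x * sqnorm y.
Proof. by rewrite -!sqnormE ComplexField.Normc.normcM exprMn. Qed.

Lemma sqnormN x : sqnorm (- x) = sqnorm x.
Proof. by rewrite /sqnorm; case: x => p q /=; rewrite !sqrrN. Qed.

Lemma sqnorm_conj x : sqnorm (conjc x) = sqnorm x.
Proof. by rewrite /sqnorm; case: x => p q /=; rewrite sqrrN. Qed.

Lemma mul_conj x : x * conjc x = (sqnorm x)%:C.
Proof.
by rewrite /sqnorm; case: x => p q; simpc => /=; congr (_ +i* _); ring.
Qed.

Lemma sqnorm1 : sqnorm 1 = 1.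
Proof. by rewrite /sqnorm /= expr1n expr0n addr0. Qed.

Lemma sqnorm0 : sqnorm 0 = 0.
Proof. by rewrite /sqnorm /= expr0n addr0. Qed.

Lemma sqnorm_eq0 x : sqnorm x = 0 -> x = 0.
Proof.
move=> /eqP; rewrite -sqnormE sqrf_eq0 => /eqP.
exact: ComplexField.Normc.eq0_normc.
Qed.

Definition det2 u v : C := u.1 * v.2 - u.2 * v.1.
Definition comb x u y v : C * C := (x * u.1 + y * v.1, x * u.2 + y * v.2).

Lemma det2_comb x y x' y' u v :
  det2 (comb x u y v) (comb x' u y' v) = (x * y' - y * x') * det2 u v.
Proof. by rewrite /det2 /=; ring. Qed.

Lemma det2C u v : det2 u v = - det2 v u.
Proof. by rewrite /det2; ring. Qed.

Lemma det2Zr x u v : det2 u (x * v.1, x * v.2) = x * det2 u v.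
Proof. by rewrite /det2 /=; ring. Qed.

Variables (z : C) (t : R).

(** The polarization of [qform]. *)
Definition hform u v : C :=
  (u.1 * z + u.2) * conjc (v.1 * z + v.2) + (t ^+ 2)%:C * (u.1 * conjc v.1).
Definition qform u : R := sqnorm (u.1 * z + u.2) + t ^+ 2 * sqnorm u.1.

Lemma qform_comb x y u v : qform (comb x u y v) =
  sqnorm x * qform u + sqnorm y * qform v +
  complex.Re (x * conjc y * hform u v) *+ 2.
Proof.
rewrite /qform /hform /comb /sqnorm.
case: x => x1 x2; case: y => y1 y2; case: u => -[u1 u2] [u3 u4].
case: v => -[v1 v2] [v3 v4]; case: z => z1 z2 /=; simpc => /=.
by rewrite mulr2n; ring.
Qed.

(** A Gram determinant scales by the squared modulus of [det2], and on the standard basis it is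
    t^2. *)
Lemma hform_gram u v :
  qform u * qform v - sqnorm (hform u v) = t ^+ 2 * sqnorm (det2 u v).
Proof.
rewrite /qform /hform /det2 /sqnorm.
case: u => -[u1 u2] [u3 u4].
case: v => -[v1 v2] [v3 v4]; case: z => z1 z2 /=; simpc => /=.
ring.
Qed.

End HermitianForm.

(** The properties of an order through which arithmetic enters the geometry; the last one is
    discreteness. *)
Definition quadratic_lattice (R : realType) (A : set R[i]) :=
  [/\ GRing.subring_closed [pred x | `[< A x >]],
      forall x, A x -> A (conjc x),
      forall x, A x -> exists n : nat, sqnorm x = n%:R
    & forall B : R, exists V : seq R[i],
        forall x, A x -> sqnorm x <= B -> x \in V].

(** * The graph of unimodular pairs *)

Section UnimodularGraph.
Variables (R : realType) (A : set R[i]).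
Local Notation C := R[i].
Hypothesis latA : quadratic_lattice A.
Implicit Types (x y : C) (u v w k a : C * C).

Lemma lat1 : A 1.
Proof. by case: latA => -[+ _ _] _ _ _ => /asboolP. Qed.

Lemma latB x y : A x -> A y -> A (x - y).
Proof.
case: latA => -[_ AB _] _ _ _ Ax Ay.
by apply/asboolP; apply: AB; apply/asboolP.
Qed.

Lemma latM x y : A x -> A y -> A (x * y).
Proof.
case: latA => -[_ _ AM] _ _ _ Ax Ay.
by apply/asboolP; apply: AM; apply/asboolP.
Qed.

Lemma lat_conj x : A x -> A (conjc x).
Proof. by case: latA => _ cA _ _; exact: cA. Qed.

Lemma lat0 : A 0.
Proof. by have := latB lat1 lat1; rewrite subrr. Qed.

Lemma latN x : A x -> A (- x).
Proof. by move=> Ax; have := latB lat0 Ax; rewrite sub0r. Qed.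

Lemma latD x y : A x -> A y -> A (x + y).
Proof. by move=> Ax Ay; have := latB Ax (latN Ay); rewrite opprK. Qed.

Definition lat2 : set (C * C) := [set u | A u.1 /\ A u.2].

Lemma lat2_comb x u y v : A x -> lat2 u -> A y -> lat2 v -> lat2 (comb x u y v).
Proof. by move=> Ax [? ?] Ay [? ?]; split; apply: latD; exact: latM. Qed.

Lemma lat_det2 u v : lat2 u -> lat2 v -> A (det2 u v).
Proof. by move=> [? ?] [? ?]; apply: latB; exact: latM. Qed.

(** Boolean, so that the theory of [path] applies. *)
Definition adj u v := [&& `[< lat2 u >], `[< lat2 v >] & sqnorm (det2 u v) == 1].

Lemma adjP u v : reflect [/\ lat2 u, lat2 v & sqnorm (det2 u v) = 1] (adj u v).
Proof.
by apply: (iffP and3P) => -[/asboolP ? /asboolP ? /eqP ?]; split.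
Qed.

Lemma adjC u v : adj u v = adj v u.
Proof. by rewrite /adj det2C sqnormN andbCA. Qed.

(** * Peaks of the form along a path, and descent *)

Section Peaks.
Variables (z : C) (t : R).
Hypothesis t_gt0 : 0 < t.
Local Notation Q := (qform z t).

Lemma qform_ge0 u : 0 <= Q u.
Proof.
rewrite /qform; apply: addr_ge0; first exact: sqnorm_ge0.
by apply: mulr_ge0; [exact: sqr_ge0|exact: sqnorm_ge0].
Qed.

(** With n = |x|^2, q = Q k, c = Q a and p = Re (x h(k, a)), the last hypothesis reads (n - 1) q + c
    <= -2p, while p^2 <= n |h|^2 = n (q c - t^2). Squaring gives ((n - 1) q + c)^2 <= 4 n (q c -
    t^2), which fails for n >= 4 and c <= q. *)
Lemma peak_multiplier_lt4 a k x : sqnorm (det2 a k) = 1 ->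
  Q a <= Q k -> Q (comb x k 1 a) <= Q k -> sqnorm x < 4.
Proof.
move=> D1 ak; rewrite qform_comb sqnorm1 mul1r conjc1 mulr1 => bk.
rewrite ltNge; apply/negP => n4.
have := hform_gram z t k a; rewrite det2C sqnormN D1 mulr1 => gram.
set h := hform _ _ _ _ in bk gram; set p := complex.Re _ in bk.
have p2 : p ^+ 2 <= sqnorm x * sqnorm h by rewrite -sqnormM lerDl sqr_ge0.
have t2 : 0 < t ^+ 2 by rewrite exprn_gt0.
have := qform_ge0 a; have := sqnorm_ge0 h; move: gram p2 bk ak n4.
move: (sqnorm x) (sqnorm h) (Q k) (Q a) (t ^+ 2) t2 p => n h2 q c s s0 p gram.
move=> p2 bk ak n4 h0 c0.
have k0 : 0 < q by nra.
have P : (n - 1) * q + c <= - (p *+ 2) by lra.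
have P0 : 0 <= (n - 1) * q + c by rewrite addr_ge0 ?mulr_ge0//; lra.
have : ((n - 1) * q + c) ^+ 2 <= 4 * p ^+ 2.
  have -> : 4 * p ^+ 2 = (- (p *+ 2)) ^+ 2 by rewrite mulr2n; ring.
  by rewrite lerXn2r// nnegrE//; exact: le_trans P.
suff : 4 * (n * h2) < ((n - 1) * q + c) ^+ 2 by lra.
have -> : h2 = q * c - s by lra.
rewrite -subr_gt0.
(* For n >= 4 and c <= q the first summand is positive and the others are nonnegative. *)
have -> : ((n - 1) * q + c) ^+ 2 - 4 * (n * (q * c - s)) =
  4 * n * s + (n * (n - 4) * q ^+ 2 + (q - c) * ((n *+ 2) * q + (q - c))).
  by rewrite mulr2n; ring.
apply: ltr_wpDr; last by rewrite !mulr_gt0//; lra.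
have [n0 n40 qc] : [/\ 0 <= n, 0 <= n - 4 & 0 <= q - c] by split; lra.
have n2q : 0 <= n *+ 2 * q by rewrite mulr_ge0 ?mulrn_wge0// ltW.
apply: addr_ge0; apply: mulr_ge0; rewrite ?sqr_ge0//; first exact: mulr_ge0.
exact: addr_ge0.
Qed.

(* For [|x|^2 = 1] the neighbours [a] and [x k + a] of the peak [k] are adjacent;
   for [n = |x|^2 = 2, 3] they lie with [k] on a 2n-cycle of the graph, which is
   the geometric form of Cohn's relation [(E(x) E(conj x))^n = -1], where [E(x)]
   has rows [(x, 1)] and [(-1, 0)].  On the rest of the cycle [qform] is smaller
   than at [k]. *)
Lemma peak_detour a k x : lat2 a -> lat2 k -> sqnorm (det2 a k) = 1 -> A x ->
  x != 0 -> Q a < Q k -> Q (comb x k 1 a) <= Q k ->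
  exists s, [/\ path adj a s, adj (last a s) (comb x k 1 a)
              & all (fun v => Q v < Q k) s].
Proof.
move=> Aa Ak D1 Ax x0 ak bk.
have n4 := peak_multiplier_lt4 D1 (ltW ak) bk.
have A2 : A (1 + 1) by exact: latD lat1 lat1.
have aE : a = comb 0 k 1 a.
  by rewrite /comb !mul0r !add0r !mul1r -surjective_pairing.
have Ab : lat2 (comb x k 1 a) by apply: lat2_comb lat1 _.
have [_ _ /(_ x Ax)[n nE] _] := latA.
have cx : x * conjc x = n%:R by rewrite mul_conj nE rmorph_nat.
have edge p q p' q' : A p -> A q -> A p' -> A q' -> p * q' - q * p' = -1 ->
    adj (comb p k q a) (comb p' k q' a).
  move=> Ap Aq Ap' Aq' e; apply/adjP; split; try exact: lat2_comb.
  have ka : sqnorm (det2 k a) = 1 by rewrite det2C sqnormN.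
  by rewrite det2_comb sqnormM ka mulr1 e sqnormN sqnorm1.
have Ax' := lat_conj Ax.
(* The values at all vertices of the detours are affine in the single real number Re (x h(k, a)),
   which the bound on [Q (comb x k 1 a)] controls; this leaves linear arithmetic. *)
have Q1 := qform_comb z t 1 (conjc x) k a.
have Qb := qform_comb z t x 1 k a.
have Q2 := qform_comb z t x (1 + 1) k a.
have Q3 := qform_comb z t (1 + 1) (conjc x) k a.
have sq2 : sqnorm (1 + 1 : C) = 4 by rewrite /sqnorm /=; ring.
have c2 : conjc (1 + 1 : C) = 1 + 1 by rewrite rmorphD rmorph1.
rewrite c2 conjcK conjc1 in Q1 Q2 Q3 Qb.
have Re2 (w : C) : complex.Re ((1 + 1) * w) = complex.Re w *+ 2.
  by rewrite mulrDl mul1r raddfD mulr2n.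
rewrite [x * (1 + 1)]mulrC -!mulrA !(mul1r, mulr1) !Re2 in Q1 Q2 Q3 Qb.
rewrite sqnorm1 sq2 sqnorm_conj nE in Q1 Q2 Q3 Qb.
move: n4; rewrite nE ltr_nat; case: n nE cx Q1 Q2 Q3 Qb =>
  [/sqnorm_eq0/eqP|n nE cx Q1 Q2 Q3 Qb].
  by rewrite (negPf x0).
have ady1 : adj a (comb 1 k (conjc x) a).
  rewrite {1}aE; apply: edge; rewrite //;
    [exact: lat0|exact: lat1|exact: lat1|ring].
case: n nE cx Q1 Q2 Q3 Qb => [|[|[|//]]] nE cx Q1 Q2 Q3 Qb _.
- exists [::]; split => //=; apply/adjP; split=> //.
  rewrite {1}aE det2_comb sqnormM.
  by rewrite det2C sqnormN D1 mulr1 mul0r mul1r sub0r sqnormN.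
- exists [:: comb 1 k (conjc x) a]; split => /=; first by rewrite ady1.
  + by apply: edge => //; try exact: lat1; rewrite [_ * x]mulrC cx; ring.
  + by rewrite andbT; move: Q1 Qb bk ak => /=; lra.
- exists [:: comb 1 k (conjc x) a; comb x k (1 + 1) a;
            comb (1 + 1) k (conjc x) a]; split => /=.
  + rewrite ady1 andbT /=; apply/andP; split; apply: edge => //; try exact: lat1.
      by rewrite [_ * x]mulrC cx; ring.
    by rewrite cx; ring.
  + by apply: edge => //; try exact: lat1; rewrite [_ * x]mulrC cx; ring.
  + rewrite andbT; move: Q1 Q2 Q3 Qb bk ak => /=; set p := complex.Re _; move=> *.
    by apply/and3P; split; lra.
Qed.

(** What is retained of v = c u with |c| = 1. *)
Definition unit_multiple u v :=
  Q v = Q u /\ forall w, adj w u -> adj w v.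

(** Cramer's rule writes u2 = x u1 + al u0 with |al| = 1. If x = 0, then u2 is a unit multiple of
    u0; otherwise [peak_detour] applies to a = al u0, which has the same value and the same
    neighbours as u0. *)
Lemma peak_removal u0 u1 u2 : adj u0 u1 -> adj u1 u2 -> Q u0 < Q u1 ->
    Q u2 <= Q u1 ->
  unit_multiple u0 u2 \/
  exists s, [/\ path adj u0 s, adj (last u0 s) u2
              & all (fun v => Q v < Q u1) s].
Proof.
move=> /adjP[A0 A1 D01] /adjP[_ A2 D12] q01 q21.
(* [d] is the inverse of a determinant of modulus 1, so [al] and [x] stay in the lattice. *)
set d := conjc (det2 u0 u1).
have dd : det2 u0 u1 * d = 1 by rewrite mul_conj D01.
have nd : sqnorm d = 1 by rewrite sqnorm_conj.
pose al := det2 u2 u1 * d; pose x := det2 u0 u2 * d.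
have Ad : A d by apply/lat_conj/lat_det2.
have Aal : A al by apply: latM => //; exact: lat_det2.
have Ax : A x by apply: latM => //; exact: lat_det2.
have nal : sqnorm al = 1 by rewrite sqnormM nd det2C sqnormN D12 mulr1.
pose a := comb al u0 0 u0.
have aE : a = (al * u0.1, al * u0.2) by rewrite /a /comb !mul0r !addr0.
have Aa : lat2 a by apply: lat2_comb => //; exact: lat0.
have u2E : u2 = comb x u1 1 a.
  rewrite aE /comb /x /al /=.
  have e1 : u2.1 * (det2 u0 u1 * d) =
      det2 u0 u2 * d * u1.1 + 1 * (det2 u2 u1 * d * u0.1).
    by rewrite /det2; ring.
  have e2 : u2.2 * (det2 u0 u1 * d) =
      det2 u0 u2 * d * u1.2 + 1 * (det2 u2 u1 * d * u0.2).
    by rewrite /det2; ring.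
  by rewrite -e1 -e2 dd !mulr1 -surjective_pairing.
have Qa : Q a = Q u0.
  by rewrite qform_comb nal sqnorm0 conjc0 mulr0 mul0r mul1r mul0r !addr0 mul0rn addr0.
have det_a w : sqnorm (det2 w a) = sqnorm (det2 w u0).
  by rewrite aE det2Zr sqnormM nal mul1r.
have adj_a w : adj w u0 -> adj w a.
  by move=> /adjP[Aw _ Dw]; apply/adjP; split; rewrite ?det_a.
have adj_a' w : adj a w -> adj u0 w.
  rewrite adjC => /adjP[Aw _ Dw]; rewrite adjC; apply/adjP; split=> //.
  by rewrite -det_a.
have [x0|x0] := eqVneq x 0.
  left; have -> : u2 = a.
    by rewrite u2E x0 /comb !mul0r !add0r !mul1r -surjective_pairing.
  by [].
right.
have Da : sqnorm (det2 a u1) = 1 by rewrite det2C sqnormN det_a det2C sqnormN.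
have qa : Q a < Q u1 by rewrite Qa.
have qb : Q (comb x u1 1 a) <= Q u1 by rewrite -u2E.
have [s [ps ls als]] := peak_detour Aa A1 Da Ax x0 qa qb; rewrite -u2E in ls.
exists s; suff [] : path adj u0 s /\ adj (last u0 s) u2 by split.
by case: s ps ls {als} => [_|y s] /= => [/adj_a'|/andP[/adj_a' -> ->]].
Qed.

(** Induction on the length of the part still to be treated: a peak of height m is replaced by a
    detour strictly below m, which needs no further treatment. When the neighbours of the peak are
    unit multiples of each other, the path restarts from the second one; hence the new origin [u'].
    The last vertex is kept and may still reach m. *)
Lemma flatten_path m u s : path adj u s -> Q u < m ->
    all (fun v => Q v <= m) s ->
  exists u' s', [/\ unit_multiple u u', path adj u' s',
    last u' s' = last u s & all (fun v => Q v < m) (belast u' s')].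
Proof.
have [n] := ubnP (size s); elim: n u s => // n IHn u [|u1 [|u2 s]] sz ps um.
- by exists u, [::].
- by exists u, [:: u1]; split=> //=; rewrite um.
move: sz ps; rewrite /= !ltnS => sz /and3P[a1 a2 ps] /and3P[m1 m2 ms].
have [u1m|mu1] := ltP (Q u1) m.
  have [||||u' [s' [[_ u'u] ps' ls' ms']]] := IHn u1 (u2 :: s) => //=.
  - by rewrite a2.
  - by rewrite m2.
  by exists u, (u' :: s'); split=> //=; rewrite ?um ?ps' ?u'u// adjC.
have Q1 : Q u1 = m by apply/eqP; rewrite eq_le m1.
have [||[Q2 adj2]|[t1 [pt lt mt]]] := peak_removal a1 a2; rewrite ?Q1//.
  have [||||u' [s' [[Qu' u'u] ps' ls' ms']]] := IHn u2 s => //=; rewrite ?Q2//.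
    exact: ltnW.
  exists u', s'; split=> //; split; first by rewrite Qu' Q2.
  by move=> w /adj2/u'u.
rewrite Q1 in mt; case/lastP: t1 pt lt mt => [_ /= lt _|t1 y].
  by apply: (IHn u (u2 :: s)) => //=; rewrite ?lt ?m2.
rewrite rcons_path last_rcons all_rcons => /andP[pt lt] y2 /andP[ym mt].
have [||||u' [s' [[_ u'u] ps' ls' ms']]] := IHn y (u2 :: s) => //=.
- by rewrite y2.
- by rewrite m2.
exists u, (t1 ++ u' :: s'); split => //.
- by rewrite cat_path /= ps' pt u'u.
- by rewrite last_cat.
have : all (fun v => Q v < m) (u :: t1) by rewrite /= um.
rewrite lastI all_rcons => /andP[ml mb].
by rewrite belast_cat all_cat mb /= ml.
Qed.

(** The term t^2 |x|^2 bounds x, and then |y|^2 <= 2 (|x z + y|^2 + |x z|^2) bounds y. *)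
Lemma lat2_qform_finite (L : R) :
  exists V : seq (C * C), forall u, lat2 u -> Q u <= L -> u \in V.
Proof.
have [_ _ _ fin] := latA.
have [V1 V1P] := fin (L / t ^+ 2).
have [V2 V2P] := fin (2 * (L + sqnorm z * (L / t ^+ 2))).
have t2 : 0 < t ^+ 2 by rewrite exprn_gt0.
exists [seq (x, y) | x <- V1, y <- V2] => -[x y] [/= Ax Ay] xyL.
have q1 : sqnorm (x * z + y) <= L.
  by apply: le_trans xyL; rewrite lerDl mulr_ge0 ?sqr_ge0 ?sqnorm_ge0.
have q2 : sqnorm x <= L / t ^+ 2.
  rewrite ler_pdivlMr// mulrC; apply: le_trans xyL.
  by rewrite lerDr sqnorm_ge0.
apply/allpairsP; exists (x, y); split=> //=; [exact: V1P|apply: V2P => //].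
have q3 : sqnorm y <= 2 * (sqnorm (x * z + y) + sqnorm (x * z)).
  rewrite /sqnorm; case: (x * z) => p q; case: (y) => r s; simpc => /=.
  by have := sqr_ge0 (p *+ 2 + r); have := sqr_ge0 (q *+ 2 + s); nra.
apply: le_trans q3 _; rewrite ler_pM2l// lerD// sqnormM mulrC.
by rewrite ler_wpM2l ?sqnorm_ge0.
Qed.

Lemma max_on_path u s : exists2 v, v \in u :: s &
  all (fun w => Q w <= Q v) (u :: s).
Proof.
elim: s u => [|w s IHs] u; first by exists u; rewrite ?mem_head //= lexx.
have [v vs vP] := IHs w; have [uv|vu] := leP (Q u) (Q v).
  exists v; first by rewrite in_cons vs orbT.
  by rewrite -cat1s all_cat vP /= uv.
exists u; rewrite ?mem_head // -cat1s all_cat [X in X && _]/= lexx.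
by apply: sub_all vP => y /le_trans; apply; exact: ltW.
Qed.

Lemma path_lat2 u s : path adj u s -> lat2 (last u s) ->
  forall v, v \in u :: s -> lat2 v.
Proof.
elim: s u => [|w s IHs] u /= => [_ Au v|/andP[/adjP[Au _ _] ps] ls v].
  by rewrite inE => /eqP ->.
by rewrite in_cons => /orP[/eqP ->|/(IHs w ps ls)].
Qed.

(** Descent on the number of lattice vectors whose value is below a strict upper bound m of the
    path; flattening the path at its maximum lowers m. *)
Lemma no_descending_path e u s : (forall v, adj v e -> Q e <= Q v) ->
  lat2 e -> path adj u s -> last u s = e -> Q e <= Q u.
Proof.
move=> emin Ae pus lus; rewrite leNgt; apply/negP => ue.
have [v0 _ v0P] := max_on_path u s.
(* The added 1 makes the initial bound strict on the whole path. *)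
have [V VP] := lat2_qform_finite (Q v0 + 1).
pose cnt (m : R) := count (fun v => Q v < m) V.
have [m mV ms] : exists2 m, forall v, lat2 v -> Q v < m -> v \in V &
    all (fun v => Q v < m) (u :: s).
  exists (Q v0 + 1) => [v Av /ltW|]; first exact: VP.
  by apply: sub_all v0P => w wv; rewrite ltr_pwDr.
have [n] := ubnP (cnt m); elim: n m u s mV ms pus lus ue {v0 v0P VP} => // n IHn.
move=> m u s mV ms pus lus ue cm.
have [v vs vP] := max_on_path u s.
have Av : lat2 v by apply: path_lat2 pus _ _ vs; rewrite lus.
have vm : Q v < m := allP ms _ vs.
have ev : Q e <= Q v by apply: (allP vP); rewrite -lus mem_last.
have uv : Q u < Q v := lt_le_trans ue ev.
move: vP => /= /andP[_ vP].
have [u' [s' [[uu' _] ps' ls' ms']]] := flatten_path pus uv vP.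
(* If the maximum is Q e, the flattened path enters e from a neighbour strictly below it, against
   [emin]. *)
move: ev; rewrite le_eqVlt => /orP[/eqP ev|ev].
  case/lastP: s' ps' ls' ms' => [|s' w] /=.
    by move=> _ u'e; move: ue; rewrite -lus -u'e uu' ltxx.
  rewrite rcons_path last_rcons belast_rcons lus => /andP[_ ae] we ms'.
  have := emin (last u' s'); rewrite -we => /(_ ae).
  by rewrite we leNgt ev (allP ms' _ (mem_last _ _)).
(* Otherwise the flattened path, e included, lies strictly below Q v, and v drops out of the
   count. *)
apply: (IHn (Q v) u' s') => //.
- by move=> w Aw /lt_trans wv; apply: mV => //; exact: wv.
- by rewrite lastI all_rcons ls' lus ev.
- by rewrite ls'.
- by rewrite uu'.
move: cm; rewrite ltnS; apply: leq_trans.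
apply: (@ltn_count _ _ _ _ v) => //.
- by move=> w /= /lt_trans; apply.
- exact: mV.
- by rewrite ltxx.
Qed.

End Peaks.
End UnimodularGraph.

(** * Integrality and discreteness of an order *)

Section Order.
Variables (R : realType) (K : fieldExtType rat) (iota : {rmorphism K -> R[i]}).
Variable O : {pred K}.
Hypotheses (imK : imaginary_quadratic iota) (ordO : is_order O).
Local Notation C := R[i].

Lemma order_basis : exists x1 x2 : K,
  [/\ forall x, x \in O <-> exists a b : int, x = x1 *~ a + x2 *~ b
    & forall y, exists p q : rat, y = p *: x1 + q *: x2].
Proof.
have [dimK _] := imK; have [_ [X]] := ordO; move: X; rewrite dimK => X bX OX.
exists X`_0, X`_1; split.
  move=> x; rewrite OX; split=> [[a ->]|[a [b ->]]].
    by exists (a ord0), (a (lift ord0 ord0)); rewrite big_ord_recl big_ord1.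
  exists [ffun i => if i == 0 then a else b].
  by rewrite big_ord_recl big_ord1 !ffunE.
move=> y; exists (coord X ord0 y), (coord X (lift ord0 ord0) y).
by rewrite {1}(coord_basis bX (memvf y)) big_ord_recl big_ord1.
Qed.

Lemma iotaZ (p : rat) (x : K) : iota (p *: x) = (ratr p)%:C * iota x.
Proof.
rewrite -mulr_algl rmorphM; congr (_ * _).
transitivity (ratr p : C); first exact: (fmorph_eq_rat (iota \o in_alg K)).
by rewrite -(fmorph_eq_rat (real_complex R \o ratr)).
Qed.

(** Multiplication by x has an integer matrix in the basis x1, x2 of the order. As a real linear map
    of the plane it has trace 2 Re x and determinant |x|^2. *)
Lemma order_integral x : x \in O -> exists T D : int,
  complex.Re (iota x) *+ 2 = T%:~R /\ sqnorm (iota x) = D%:~R.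
Proof.
have [x1 [x2 [OE span]]] := order_basis; move=> xO.
have OM : {in O &, forall y w, y * w \in O} by case: ordO => -[].
have x1O : x1 \in O by apply/OE; exists 1, 0; rewrite mulr0z addr0.
have x2O : x2 \in O by apply/OE; exists 0, 1; rewrite mulr0z add0r.
have [a [b]] := (OE _).1 (OM _ _ xO x1O).
have [c [d]] := (OE _).1 (OM _ _ xO x2O).
move=> /(congr1 iota) e2 /(congr1 iota) e1.
rewrite rmorphM rmorphD !rmorphMz in e1 e2.
have Re_int (w : C) (m : int) : complex.Re (w *~ m) = complex.Re w * m%:~R.
  by rewrite raddfMz mulrzr.
have Im_int (w : C) (m : int) : complex.Im (w *~ m) = complex.Im w * m%:~R.
  by rewrite raddfMz mulrzr.
(* For a real linear map M, area(M v, w) + area(v, M w) = tr M area(v, w) and area(M v, M w) = det M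
   area(v, w). *)
pose area (v w : C) :=
  complex.Re v * complex.Im w - complex.Im v * complex.Re w.
(* If the two basis vectors were proportional over the reals, their span, which contains 1, would be
   the real line, and the image of K would be real. *)
have basis_area : area (iota x1) (iota x2) != 0.
  have [_ [y yIm]] := imK; apply: contra_neq yIm => a0.
  have [p [q /(congr1 iota)]] := span y; have [r [s /(congr1 iota)]] := span 1.
  rewrite !rmorphD rmorph1 !iotaZ => e ->.
  move: e a0; rewrite /area.
  case: (iota x1) => p1 q1; case: (iota x2) => p2 q2; simpc => -[/= e3 e4] a0.
  rewrite -complexIm /=.
  have -> : ratr p * q1 + ratr q * q2 = 0 :> R; last by [].
  move: (ratr p : R) (ratr q : R) (ratr r : R) (ratr s : R) e3 e4.
  move=> {}p {}q {}r {}s e3 e4.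
  rewrite -[RHS](mulr0 (r * q - s * p)) -a0.
  rewrite -[LHS]mul1r -[LHS]subr0 -[X in _ - X](mulr0 (p * p1 + q * p2)).
  by rewrite e3 e4; ring.
rewrite rmorphM rmorphD !rmorphMz in e2.
have [e1r e1i] := (congr1 (@complex.Re R) e1, congr1 (@complex.Im R) e1).
have [e2r e2i] := (congr1 (@complex.Re R) e2, congr1 (@complex.Im R) e2).
rewrite !raddfD /= !Re_int !Im_int in e1r e1i e2r e2i.
exists (a + d), (a * d - b * c); split; apply: (mulIf basis_area).
  move: e1r e1i e2r e2i; rewrite /area intrD.
  case: (iota x) => s r; case: (iota x1) => p q; case: (iota x2) => u v /=.
  move=> e1r e1i e2r e2i.
  transitivity ((p * a%:~R + u * b%:~R) * v - (q * a%:~R + v * b%:~R) * u +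
    (p * (q * c%:~R + v * d%:~R) - q * (p * c%:~R + u * d%:~R))); last by ring.
  by rewrite -e1r -e1i -e2r -e2i mulr2n; ring.
move: e1r e1i e2r e2i; rewrite /area intrB !intrM /sqnorm.
case: (iota x) => s r; case: (iota x1) => p q; case: (iota x2) => u v /=.
move=> e1r e1i e2r e2i.
transitivity ((p * a%:~R + u * b%:~R) * (q * c%:~R + v * d%:~R) -
  (q * a%:~R + v * b%:~R) * (p * c%:~R + u * d%:~R)); last by ring.
by rewrite -e1r -e1i -e2r -e2i; ring.
Qed.

Lemma order_lattice : quadratic_lattice (iota @` [set` O]).
Proof.
have [x1 [x2 [OE _]]] := order_basis.
have [ [ O1 OB OM] _] := ordO.
have O_int (m : int) : m%:~R \in O.
  rewrite -[m%:~R](mulr1 (m%:~R : K)) mulrzl.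
  have O0 : 0 \in O by rewrite -(subrr 1); exact: OB.
  have On n : 1 *+ n \in O.
    elim: n => // n IHn; rewrite mulrS -[1 *+ n]opprK; apply: (OB) => //.
    by rewrite -[- _]sub0r; exact: OB.
  case: m => n; first exact: On.
  by rewrite NegzE mulrNz -[- _]sub0r; apply: (OB) => //; exact: On.
split.
- split=> [|_ _ /asboolP[x xO <-] /asboolP[y yO <-]
           |_ _ /asboolP[x xO <-] /asboolP[y yO <-]]; apply/asboolP.
  + by exists 1; [exact: O1|exact: rmorph1].
  + by exists (x - y); rewrite ?rmorphB//=; exact: (OB).
  + by exists (x * y); rewrite ?rmorphM//=; exact: (OM).
- move=> _ [x xO <-]; have [T [_ [eT _]]] := order_integral xO.
  (* The conjugate of x is its trace minus x. *)
  exists (T%:~R - x); first exact: (OB _ _ (O_int T) xO).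
  rewrite rmorphB rmorph_int; move: eT; case: (iota x) => p q /= eT.
  rewrite -(rmorph_int (real_complex R)) -eT; simpc => /=; congr (_ +i* _).
  by rewrite mulr2n addrK.
- move=> _ [x xO <-]; have [_ [D [_ eD]]] := order_integral xO.
  have := sqnorm_ge0 (iota x); rewrite eD ler0z.
  by case: D {eD} => [n _|n]; [exists n; rewrite pmulrn|rewrite NegzE oppr_ge0].
move=> B; have [b Bb] : exists b : nat, B <= b%:R.
  exists (Num.bound `|B|); apply: le_trans (ler_norm B) _.
  exact/ltW/archi_boundP.
(* The real part is k/2 up to sign with k^2 <= 4b, hence k <= 4b; a norm n <= b then determines the
   imaginary part up to sign. *)
pose rp := [seq k%:R / 2 | k <- index_iota 0 (4 * b).+1] : seq R.
pose ip (p : R) :=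
  [seq Num.sqrt (n%:R - p ^+ 2) | n <- index_iota 0 b.+1] : seq R.
pose signs (V : seq R) := V ++ [seq - p | p <- V].
exists [seq p +i* q | p <- signs rp, q <- signs (ip p)].
move=> _ [x xO <-] xB; have [T [D [eT eD]]] := order_integral xO.
have signsP (V : seq R) p q : `|p| = q -> q \in V -> p \in signs V.
  move=> <- pV; rewrite mem_cat; have [p0|p0] := leP 0 p.
    by rewrite -(ger0_norm p0) pV.
  by apply/orP; right; apply/mapP; exists `|p|; rewrite // ltr0_norm// opprK.
move: eT eD xB; case: (iota x) => p q; rewrite /sqnorm.
rewrite [complex.Re _]/= [complex.Im _]/= => eT eD xB.
have D0 : 0 <= D by rewrite -(ler0z R) -eD addr_ge0 ?sqr_ge0.
case: D D0 eD => // n _ eD.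
have nb : (n <= b)%N by rewrite -(ler_nat R) -[n%:R]eD; exact: le_trans Bb.
have pE : `|p| = `|T|%N%:R / 2.
  by rewrite natr_absz intr_norm -eT normrMn mulr2n; lra.
apply: allpairs_f_dep.
- apply: (signsP _ _ _ pE); apply/mapP; exists `|T|%N => //.
  rewrite mem_index_iota /= ltnS.
  have kb : (`|T| * `|T| <= 4 * b)%N.
    rewrite -(ler_nat R) !natrM -expr2.
    have -> : (`|T|%N%:R : R) = `|p| * 2 by rewrite pE; lra.
    by rewrite exprMn real_normK ?num_real//; have := sqr_ge0 q; nra.
  by apply: leq_trans kb; case: `|T|%N => // k; rewrite leq_pmulr.
- apply: (signsP _ _ (Num.sqrt (n%:R - p ^+ 2))).
    by rewrite -sqrtr_sqr; congr Num.sqrt; rewrite -[n%:R]eD; ring.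
  by apply/mapP; exists n; rewrite // mem_index_iota ltnS.
Qed.

End Order.

(** * Bottom rows of the elementary group *)

Section ElementaryRows.
Variables (R : realType) (A : set R[i]).
Local Notation C := R[i].
Hypothesis latA : quadratic_lattice A.
Implicit Types (x y : C) (u v w : C * C) (M N : 'M[C]_2).

Definition row1 M : C * C := (M 1 0, M 1 1).
Definition mulrow u M : C * C :=
  (u.1 * M 0 0 + u.2 * M 1 0, u.1 * M 0 1 + u.2 * M 1 1).
Local Notation e := ((0, 1) : C * C).

Lemma big_ord2 (F : 'I_2 -> C) : \sum_i F i = F 0 + F 1.
Proof. by rewrite big_ord_recl big_ord1; congr (_ + F _); apply/val_inj. Qed.

Lemma row1M M N : row1 (M *m N) = mulrow (row1 M) N.
Proof. by rewrite /row1 /mulrow !mxE !big_ord2. Qed.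

Lemma mulrow_base M : mulrow e M = row1 M.
Proof. by rewrite /mulrow /= !mul0r !add0r !mul1r. Qed.

Lemma row1_1 : row1 1%:M = e.
Proof. by rewrite /row1 !mxE. Qed.

Lemma det_mx2 M : \det M = M 0 0 * M 1 1 - M 0 1 * M 1 0.
Proof.
rewrite (expand_det_row _ 0) big_ord2 /cofactor !det_mx11 !mxE.
rewrite expr0 mul1r expr1 mulN1r mulrN; congr (_ * M _ _ - _ * M _ _);
  exact/val_inj.
Qed.

Lemma det2_mulrow u v M : det2 (mulrow u M) (mulrow v M) = det2 u v * \det M.
Proof. by rewrite det_mx2 /det2 /=; ring. Qed.

Definition entries_in M := forall i j, A (M i j).

Lemma adj_mulrow u v M : \det M = 1 -> entries_in M ->
  adj A u v -> adj A (mulrow u M) (mulrow v M).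
Proof.
move=> M1 AM /adjP[[Au1 Au2] [Av1 Av2] uv]; apply/adjP.
split; rewrite ?det2_mulrow ?M1 ?mulr1//; split;
  by apply: (latD latA); apply: (latM latA).
Qed.

Definition linked u v := exists2 s, path (adj A) u s & last u s = v.

Lemma linked_trans u v w : linked u v -> linked v w -> linked u w.
Proof.
move=> [s ps <-] [s' ps' <-]; exists (s ++ s'); last by rewrite last_cat.
by rewrite cat_path ps.
Qed.

Lemma linked_adj u v : adj A u v -> linked u v.
Proof. by move=> uv; exists [:: v]; rewrite //= uv. Qed.

Lemma linked_sym u v : linked u v -> linked v u.
Proof.
move=> [s]; elim: s u => [u _ /= ->|w s IHs u /= /andP[uw ps] sv].
  by exists [::].
by apply: linked_trans (IHs _ ps sv) _; apply: linked_adj; rewrite adjC.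
Qed.

Lemma linked_mulrow u v M : \det M = 1 -> entries_in M ->
  linked u v -> linked (mulrow u M) (mulrow v M).
Proof.
move=> M1 AM [s ps <-]; exists (map (mulrow^~ M) s); last first.
  exact: (last_map (mulrow^~ M)).
apply: (homo_path (f := mulrow^~ M)) ps => x y.
exact: adj_mulrow.
Qed.

Definition reachable M := entries_in M /\ linked e (row1 M).

Lemma reachable1 : reachable 1%:M.
Proof.
split=> [i j|]; last by rewrite row1_1; exists [::].
by rewrite mxE; case: (i == j); [exact: lat1|exact: lat0].
Qed.

(** Right multiplication by N preserves adjacency, so it carries a path from e to the row of M to
    one from the row of N to that of M N. *)
Lemma reachableM M N : \det N = 1 ->
  reachable M -> reachable N -> reachable (M *m N).
Proof.
move=> N1 [AM eM] [AN eN]; split=> [i j|].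
  by rewrite mxE big_ord2; apply: (latD latA); apply: (latM latA).
rewrite row1M; apply: linked_trans eN _; rewrite -mulrow_base.
exact: linked_mulrow.
Qed.

Lemma reachableV M : \det M = 1 -> reachable M -> reachable (invmx M).
Proof.
move=> M1 [AM eM]; have uM : M \in unitmx by rewrite unitmxE M1 unitr1.
have AV : entries_in (invmx M).
  move=> i j; rewrite /invmx uM M1 invr1 scale1r mxE /cofactor det_mx11 !mxE.
  apply: (latM latA) => //; elim: (_ + _)%N => [|k Ak]; first exact: lat1.
  by rewrite exprS mulN1r; exact: latN.
split=> //; apply: linked_sym; rewrite -row1_1 -(mulmxV uM) row1M.
rewrite -mulrow_base; apply: linked_mulrow => //.
by rewrite det_inv M1 invr1.
Qed.

Lemma lat_unit x y : A x -> A y -> x * y = 1 -> sqnorm y = 1.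
Proof.
have [_ _ nat_sqnorm _] := latA.
move=> /nat_sqnorm[m mE] /nat_sqnorm[n nE] /(congr1 (@sqnorm R)).
rewrite sqnormM sqnorm1 mE nE -natrM => /eqP.
by rewrite (eqr_nat _ _ 1) muln_eq1 => /andP[_ /eqP ->].
Qed.

(** The path goes through (1, 0), which is adjacent to e and to every row (c, d) with |d| = 1.
    Diagonal and triangular matrices have a unit as last entry; the permutation matrix has the row
    (1, 0) itself. *)
Lemma elementary_reachable M : \det M = 1 -> entries_in M ->
  elementary_mx M -> reachable M.
Proof.
move=> M1 AM elM; split=> //.
have [A0 A1] := (lat0 latA, lat1 latA).
have eP : adj A e (1, 0).
  by apply/adjP; split=> //; rewrite /det2 /= mul0r mul1r sub0r sqnormN sqnorm1.
apply: linked_trans (linked_adj eP) _.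
have unit_link : sqnorm (M 1 1) = 1 \/ row1 M = (1, 0) -> linked (1, 0) (row1 M).
  case=> [d1|->]; last by exists [::].
  apply: linked_adj; apply/adjP; split; [by []|by split; exact: AM|].
  by rewrite /det2 /= mul0r subr0 mul1r.
apply: unit_link.
have unit_diag : M 0 1 * M 1 0 = 0 -> sqnorm (M 1 1) = 1.
  by move=> bc0; apply: (lat_unit (AM 0 0)) => //; rewrite -M1 det_mx2 bc0 subr0.
case/or4P: elM => [/is_diag_mxP dM|/is_trig_mxP tM|/is_trig_mxP tM|/eqP ->].
- by left; apply: unit_diag; rewrite dM ?mul0r.
- by left; apply: unit_diag; rewrite tM ?mul0r.
- by left; apply: unit_diag; have := tM 0 1 isT; rewrite mxE => ->; rewrite mulr0.
- by right; rewrite /row1 !mxE.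
Qed.

(** Stated for some representative, since the one chosen by [PSL2_mx] is known only up to sign. *)
Lemma PE2_reachable g : PE2 A g ->
  exists M : SL2 C, PSL2_class M = g /\ reachable M.
Proof.
pose H := [set g | exists M : SL2 C, PSL2_class M = g /\ reachable M].
suff: PE2 A `<=` H by apply.
apply: smallest_sub; first split.
- by exists (SL2_one _); split=> //; exact: reachable1.
- move=> _ _ [M [<- rM]] [N [<- rN]]; exists (SL2_mul M N).
  by split; [exact: PSL2_classM|apply: reachableM; rewrite ?det_SL2].
- move=> _ [M [<- rM]]; exists (SL2_inv M).
  by split; [exact: PSL2_classV|apply: reachableV; rewrite ?det_SL2].
- move=> _ [M [AM elM] <-]; exists M; split=> //.
  by apply: elementary_reachable => //; exact: det_SL2.
Qed.

Lemma qformN z t u : qform z t (- u.1, - u.2) = qform z t u.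
Proof. by rewrite /qform /= mulNr -opprD !sqnormN. Qed.

Lemma psl2_act_qform (g : PSL2 C) (P : C * R) :
  (psl2_act g P).2 = P.2 / qform P.1 P.2 (row1 (PSL2_mx g)).
Proof. by rewrite /psl2_act /poincare_mx /qform /= !sqnormE [_ * P.2 ^+ 2]mulrC. Qed.

Lemma qform_row1_class z t (M : SL2 C) :
  qform z t (row1 (PSL2_mx (PSL2_class M))) = qform z t (row1 M).
Proof.
rewrite /PSL2_mx; have [->//|->] := repr_PSL2_class M.
by rewrite -[RHS]qformN /row1 !mxE.
Qed.

Lemma PE2_qform_ge1 z t g : 0 < t ->
  (forall x, A x -> 1 <= sqnorm (z - x) + t ^+ 2) -> PE2 A g ->
  1 <= qform z t (row1 (PSL2_mx g)).
Proof.
move=> t0 out /PE2_reachable[M [<- [AM /linked_sym[s ps ls]]]].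
have [A0 A1] := (lat0 latA, lat1 latA).
rewrite qform_row1_class.
have eE : qform z t e = 1 by rewrite /qform /= mul0r add0r sqnorm1 sqnorm0 mulr0 addr0.
rewrite -[leLHS]eE; apply: (no_descending_path latA t0) ps ls => //.
move=> [x y] /adjP[[/= Ax Ay] _]; rewrite /det2 /= mulr1 mulr0 subr0 => x1.
(* As |x| = 1, the row (x, y) belongs to the unit hemisphere centred at -y/x, and 1/x is the
   conjugate of x. *)
have := out (- (conjc x * y)); rewrite eE /qform /= x1 mulr1 opprK.
suff -> : sqnorm (z + conjc x * y) = sqnorm (x * z + y).
  by apply; apply: (latN latA); apply: (latM latA) => //; exact: lat_conj.
have cx : conjc x * x = 1 by rewrite mulrC mul_conj x1.
by rewrite -[z in LHS]mul1r -cx -mulrA -mulrDr sqnormM sqnorm_conj x1 mul1r.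
Qed.

(** The permutation matrix times the translation by -x lies in the group and has bottom row (1, -x),
    so its isometric hemisphere is the unit one centred at x. *)
Lemma ford_domain_outside (F : set C) (P : C * R) x :
  ford_domain (PE2 A) F P -> A x -> 1 <= sqnorm (P.1 - x) + P.2 ^+ 2.
Proof.
move=> [P0 _ hP] Ax; have [A0 A1] := (lat0 latA, lat1 latA).
have AN : A (-1) by exact: latN.
have dS : \det (permutation_mx2 C) == 1.
  by rewrite det_mx2 !mxE /= mul0r sub0r mulN1r opprK.
pose Tx : 'M[C]_2 := \matrix_(i, j) (if i == j then 1 else if i == 0 then - x else 0).
have dT : \det Tx == 1 by rewrite det_mx2 !mxE /= mulr1 mulr0 subr0.
have genS : PE2 A (PSL2_class (MkSL2 dS)).
  move=> H [_ genH]; apply: genH; exists (MkSL2 dS) => //; split => /=.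
    by move=> i j; rewrite mxE; do 2?case: ifP.
  by rewrite /elementary_mx eqxx !orbT.
have genT : PE2 A (PSL2_class (MkSL2 dT)).
  move=> H [_ genH]; apply: genH; exists (MkSL2 dT) => //; split => /=.
    by move=> i j; rewrite mxE; do 2?case: ifP => // _; exact: latN.
  apply/or4P/Or43/is_trig_mxP => i j ij; rewrite !mxE.
  by case: i j ij => -[|[|//]] ? [[|[|//]] ?].
have gen : PE2 A (PSL2_mul (PSL2_class (MkSL2 dS)) (PSL2_class (MkSL2 dT))).
  move=> H HH; have [_ HM _] := HH.1.
  by apply: HM; [exact: (genS H HH)|exact: (genT H HH)].
have := hP _ gen; rewrite psl2_act_qform -PSL2_classM qform_row1_class /= row1M.

rewrite /mulrow /row1 !mxE /= !mul1r !mul0r !addr0 /qform /= sqnorm1 mulr1 mul1r.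
set q := _ + _ => qP.
have q0 : 0 < q by rewrite ltr_wpDl ?sqnorm_ge0// exprn_gt0.
by move: qP; rewrite ler_pdivrMr// ler_pMr.
Qed.

End ElementaryRows.

(** * Moving points vertically and along a hemisphere *)

Section Faces.
Variables (R : realType) (A : set R[i]).
Local Notation C := R[i].
Hypothesis latA : quadratic_lattice A.

Lemma lower_outside (z : C) (t : R) : 0 < t ->
  (forall x, A x -> 1 < sqnorm (z - x) + t ^+ 2) ->
  exists t', [/\ 0 < t', t' < t &
    forall x, A x -> 1 <= sqnorm (z - x) + t' ^+ 2].
Proof.
move=> t0 out; have [_ _ _ fin] := latA.
(* [V] contains every lattice point within distance 1 of z, as |x|^2 <= 2 (|z - x|^2 + |z|^2).
   Lattice points farther away impose no condition on the height, and the finitely many others leave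
   a common margin d. *)
have [V VP] := fin (2 * (1 + sqnorm z)).
have [d [d0 dt dV]] : exists d, [/\ 0 < d, d < t ^+ 2 & forall x, A x -> x \in V ->
    1 + d <= sqnorm (z - x) + t ^+ 2].
  elim: V {VP} => [|y V [d [d0 dt dV]]].
    exists (t ^+ 2 / 2); split=> //; have : 0 < t ^+ 2 by rewrite exprn_gt0.
      by move=> ?; lra.
    by move=> ?; lra.
  have [Ay|nAy] := pselect (A y); last first.
    exists d; split=> // x Ax; rewrite inE => /orP[/eqP xy|]; last exact: dV.
    by rewrite xy in Ax.
  exists (Num.min d (sqnorm (z - y) + t ^+ 2 - 1)); split.
  - by rewrite lt_min d0 subr_gt0 out.
  - by rewrite gt_min dt.
  - move=> x Ax; rewrite inE => /orP[/eqP ->|xV].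
      by rewrite -lerBrDl ge_min lexx orbT.
    by apply: le_trans (dV x Ax xV); rewrite lerD2l ge_min lexx.
have td : 0 < t ^+ 2 - d by rewrite subr_gt0.
exists (Num.sqrt (t ^+ 2 - d)); rewrite sqrtr_gt0; split=> //.
  rewrite -[ltRHS](ger0_norm (ltW t0)) -sqrtr_sqr ltr_sqrt ?exprn_gt0//.
  by rewrite ltrBlDr ltrDl.
move=> x Ax; rewrite sqr_sqrtr ?(ltW td)//; have [xV|xV] := boolP (x \in V).
  by rewrite addrA lerBrDr; exact: dV.
have [zx|zx] := leP 1 (sqnorm (z - x)); first by rewrite ler_wpDr// ltW.
move: xV; rewrite (VP x Ax) //.
have : sqnorm x <= 2 * (sqnorm (z - x) + sqnorm z).
  rewrite /sqnorm; case: (z) => p q; case: (x) => u v; simpc => /=.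
  by have := sqr_ge0 (p *+ 2 - u); have := sqr_ge0 (q *+ 2 - v); nra.
by lra.
Qed.

End Faces.

Lemma near_segment (R : realType) (z w : R[i]) (B : set R[i]) : nbhs z B ->
  \forall s \near (0 : R), B (z + s%:C * w).
Proof.
move=> /nbhs_normP[e /= e0 zB].
(* Radii here are elements of R[i]; positivity forces the imaginary part to vanish. *)
have [d d0 ed] : exists2 d : R, 0 < d & e = d%:C.
  case: e e0 {zB} => d f; rewrite ltcE /= => /andP[/eqP -> d0].
  by exists d.
have nw : 0 <= normc w by case: (w) => ? ?; exact: sqrtr_ge0.
have dw : 0 < d / (1 + normc w) by rewrite divr_gt0// ltr_pwDl.
near=> s; apply: zB; rewrite /ball_ /= opprD addrA subrr sub0r normrN ed.
have -> : `|s%:C * w| = (`|s| * normc w)%:C.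
  rewrite -[LHS]/((normc (s%:C * w))%:C) ComplexField.Normc.normcM.
  by rewrite /= expr0n addr0 sqrtr_sqr.
rewrite ltcR; apply: (@le_lt_trans _ _ (`|s| * (1 + normc w))).
  by rewrite ler_wpM2l// lerDr.
rewrite -ltr_pdivlMr ?ltr_pwDl//; near: s.
Unshelve. all: by end_near.
Qed.

(** The hemisphere is the graph of a square root, continuous along the segment, so a small step in
    direction w lifts to a nearby point of it. *)
Lemma hemisphere_segment (R : realType) (c w : R[i]) (r : R) P D :
  hemisphere c r P -> within (hemisphere c r) (nbhs P) D ->
  exists s t, [/\ 0 < s, hemisphere c r (P.1 + s%:C * w, t)
    & D (P.1 + s%:C * w, t)].
Proof.
case: P => z t [t0 /= zt] [[B I] [/= zB tI] BI]; rewrite /upper_half_space /= in t0.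
pose h s := r ^+ 2 - sqnorm (z + s%:C * w - c).
have ht : Num.sqrt (h 0) = t.
  by rewrite /h mul0r addr0 -zt sqnormE addrC addKr sqrtr_sqr gtr0_norm.
have hc : {for 0, continuous (Num.sqrt \o h)}.
  apply: continuous_comp; last exact: sqrt_continuous.
  have [a [b ->]] : exists a b, h = fun s => h 0 + s * (a + s * b).
    exists (- complex.Re ((z - c) * conjc w) *+ 2), (- sqnorm w).
    apply/funext => s; rewrite /h /sqnorm.
    case: (z) => z1 z2; case: (c) => c1 c2.
    by case: (w) => w1 w2; simpc => /=; ring.
  apply: cvgD; [exact: cvg_cst|apply: cvgM; first exact: cvg_id].
  apply: cvgD; [exact: cvg_cst|apply: cvgM; [exact: cvg_id|exact: cvg_cst]].
have hI : \forall s \near (0 : R), I (Num.sqrt (h s)) 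
  by apply: (hc I); rewrite /= ht.
have hp : \forall s \near (0 : R), 0 < Num.sqrt (h s).
  by apply: (hc [set u | 0 < u]); rewrite /= ht; exact: lt_nbhsr.
have /nbhs_normP[e /= e0 eP] : \forall s \near (0 : R),
    [/\ B (z + s%:C * w), I (Num.sqrt (h s)) & 0 < Num.sqrt (h s)].
  by apply: filterS3 (near_segment w zB) hI hp; split.
have [] := eP (e / 2).
  by rewrite /ball_ /= sub0r normrN gtr0_norm ?divr_gt0//; lra.
move=> Bs Is hs; exists (e / 2), (Num.sqrt (h (e / 2))).
have S : hemisphere c r (z + (e / 2)%:C * w, Num.sqrt (h (e / 2))).
  split=> //=; rewrite sqnormE sqr_sqrtr; first by rewrite addrC subrK.
  by rewrite ltW// -sqrtr_gt0.
by split; [rewrite divr_gt0|exact: S|apply: (BI (_, _))].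
Qed.

Theorem theorem1p2 (R : realType) (K : fieldExtType rat)
    (iota : {rmorphism K -> R[i]}) (O : {pred K}) (F : set R[i])
    (g : PSL2 R[i]) :
  imaginary_quadratic iota -> is_order O ->
  let A : set R[i] := iota @` [set` O] in
  fundamental_polygon A F ->
  PE2 A g -> beta g != 0 ->
  contributes_face (isometric_hemisphere g) (ford_domain (PE2 A) F) ->
  isometric_radius g = 1 /\ A (isometric_center g).
Proof.
move=> imK ordO A _ gA b0 [P]; have latA : quadratic_lattice A := order_lattice imK ordO.
rewrite /interior /= => nP; have [SP DP] := nbhs_singleton nP.
(* Turns the interior in the subspace topology into a neighbourhood of P within the hemisphere. *)
move: nP; rewrite -[nbhs _](@nbhs_subspace_in _ (isometric_hemisphere g))// => wP.
have [P0 Pg] := SP.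
rewrite isometric_hemisphereE// in SP wP.
have [[x [Ax x1]]|none] := pselect (exists x, A x /\ sqnorm (P.1 - x) + P.2 ^+ 2 = 1).
  (* On S_g the quantity |z - x|^2 + t^2 - 1 is affine in z and decreases towards
     x: moving there would leave the Ford domain unless x is the centre. *)
  have [s [t [s0 [_ /=]]]] := hemisphere_segment (x - isometric_center g) SP wP.
  have [_ /=] := SP; rewrite !sqnormE.
  move=> e1 e2 [_ /(ford_domain_outside latA)/(_ Ax) /= x2].
  have xc : isometric_center g = x.
    apply/eqP; rewrite eq_sym -subr_eq0; apply/eqP/sqnorm_eq0.
    apply/eqP; rewrite eq_le sqnorm_ge0 andbT.
    (* With c the centre of S_g, the relations [e1], [e2], [x1], [x2] combine to 2 s |x - c|^2 <=
       0. *)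
    rewrite -(pmulr_rle0 _ s0).
    move: e1 e2 x1 x2; rewrite /sqnorm; case: (isometric_center g) => c1 c2.
    case: (P.1) => z1 z2; case: (x) => x1 x2; simpc => /=; lra.
  split; last by rewrite xc.
  have := SP.2; rewrite xc sqnormE x1 => /esym/eqP.
  rewrite sqrf_eq1 => /orP[/eqP//|/eqP r1].
  have : 0 <= isometric_radius g.
    by rewrite /isometric_radius invr_ge0; case: (beta g) => ? ?; exact: sqrtr_ge0.
  by rewrite r1 lerNr oppr0 ler10.
exfalso.
have [x Ax|t [t0 tP out]] := lower_outside (z := P.1) latA P0.
  rewrite lt_neqAle (ford_domain_outside latA DP Ax) andbT.
  by apply/eqP => x1; apply: none; exists x.
have := PE2_qform_ge1 latA t0 out gA; apply/negP; rewrite -ltNge.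
(* On S_g the form takes the value 1 at the bottom row of g, whose first entry is nonzero; at the
   smaller height t the value is therefore below 1. *)
have qP : qform P.1 P.2 (row1 (PSL2_mx g)) = 1.
  have := Pg; rewrite psl2_act_qform => /eqP.
  rewrite -[X in X == _]mulr1 -subr_eq0 -mulrBr mulf_eq0 (gt_eqF P0) /=.
  by rewrite subr_eq0 eq_sym invr_eq1 => /eqP.
rewrite -[ltRHS]qP /qform ltrD2l ltr_pM2r ?ltrXn2r ?ltW//.
rewrite lt_neqAle sqnorm_ge0 andbT eq_sym; apply: contra b0 => /eqP/sqnorm_eq0.
by rewrite /beta /row1 /= => ->; rewrite oppr0.
Qed.
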